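(* Let $\diamond$ be one of the binary operations join ($\sqcup$), disjoint join, joint join, meet ($\sqcap$), or delta. Then there exist, for each positive integer $m$, a finite ground set $U_m$ with $|U_m|=O(m)$, a total order $<_m$ on $U_m$, and families $\mathcal{F}_m,\mathcal{G}_m$ of subsets of $U_m$ such that $Z_{<_m}(\mathcal{F}_m)+Z_{<_m}(\mathcal{G}_m)=O(m^3)$ and $Z_{<_m}(\mathcal{F}_m\diamond\mathcal{G}_m)=\Omega(2^{m/5}/m)$.
   Context: A family of sets is a set of subsets of a finite ground set $U$. Operations on families $\mathcal{F},\mathcal{G}$: join $\mathcal{F}\sqcup\mathcal{G}=\{F\cup G\mid F\in\mathcal{F},G\in\mathcal{G}\}$; disjoint join $=\{F\cup G\mid F\in\mathcal{F},G\in\mathcal{G},F\cap G=\emptyset\}$; joint join $=\{F\cup G\mid F\in\mathcal{F},G\in\mathcal{G},F\cap G\neq\emptyset\}$; meet $\mathcal{F}\sqcap\mathcal{G}=\{F\cap G\mid F\in\mathcal{F},G\in\mathcal{G}\}$; delta $=\{F\oplus G\mid F\in\mathcal{F},G\in\mathcal{G}\}$ where $\oplus$ is symmetric difference of sets. A zero-suppressed binary decision diagram (ZDD) with respect to a total order $<$ on $U$ is a rooted DAG with two terminal nodes $\top,\bot$ (no outgoing arcs) and internal nodes $\mathtt{n}$, each having a label $\mathsf{lb}(\mathtt{n})\in U$ and two children $\mathsf{lo}(\mathtt{n}),\mathsf{hi}(\mathtt{n})$, such that $\mathsf{lb}(\mathtt{n})<\mathsf{lb}(\mathtt{c})$ for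 every internal child $\mathtt{c}$ of $\mathtt{n}$. The family represented by a node is: $\{\emptyset\}$ for $\top$, $\emptyset$ for $\bot$, and $\mathcal{F}_{\mathsf{lo}(\mathtt{n})}\cup\{\{\mathsf{lb}(\mathtt{n})\}\cup S\mid S\in\mathcal{F}_{\mathsf{hi}(\mathtt{n})}\}$ for an internal node; the ZDD represents the family of its root. The reduced ZDD of a family is the one obtained by repeatedly merging nodes with identical label, lo-child and hi-child, and deleting nodes whose hi-child is $\bot$ (redirecting incoming arcs to their lo-child); it is the unique smallest ZDD representing the family for the given order. $Z_<(\mathcal{F})$ denotes the number of nodes of the reduced ZDD of $\mathcal{F}$ with respect to $<$. Asymptotic notation is as $m\to\infty$. *)

(* Defs.v *)
From HB Require Import structures.
From mathcomp Require Import all_boot all_order.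
From mathcomp Require Import boolp.

Set Implicit Arguments.
Unset Strict Implicit.
Unset Printing Implicit Defensive.

Import Order.TTheory.

Section FamilyOperations.
Variable U : finType.
Implicit Types F G : {set {set U}}.

Definition join F G : {set {set U}} := [set A :|: B | A in F, B in G].

Definition disjoint_join F G : {set {set U}} :=
  [set A :|: B | A in F, B in G & A :&: B == set0].

Definition joint_join F G : {set {set U}} :=
  [set A :|: B | A in F, B in G & A :&: B != set0].

Definition meet F G : {set {set U}} := [set A :&: B | A in F, B in G].

Definition symdiff (A B : {set U}) : {set U} := (A :\: B) :|: (B :\: A).

Definition delta F G : {set {set U}} := [set symdiff A B | A in F, B in G].

End FamilyOperations.

Inductive family_op := Join | DisjointJoin | JointJoin | Meet | Delta.

Definition apply_op (op : family_op) (U : finType) (F G : {set {set U}}) :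
    {set {set U}} :=
  match op with
  | Join => join F G
  | DisjointJoin => disjoint_join F G
  | JointJoin => joint_join F G
  | Meet => meet F G
  | Delta => delta F G
  end.

(* A vertex is [inl n] for an internal node n, [inr true] for the terminal    *)
(* top, and [inr false] for the terminal bottom.                              *)
Definition arc (N : finType) (lo hi : N -> N + bool) : rel (N + bool) :=
  fun v w => if v is inl n then (w == lo n) || (w == hi n) else false.

(* Acyclicity follows from zdd_ordered.                                       *)
Record zdd (d : Order.disp_t) (U : finOrderType d) := ZDD {
  znode : finType;
  zlb : znode -> U;
  zlo : znode -> znode + bool;
  zhi : znode -> znode + bool;
  zroot : znode + bool;
  zdd_ordered : forall n c, arc zlo zhi (inl n) (inl c) -> (zlb n < zlb c)%O;
  zdd_rooted : forall v : znode, connect (arc zlo zhi) zroot (inl v) }.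

Section ZDD.
Context {d : Order.disp_t} {U : finOrderType d}.
Implicit Types (D : zdd U) (F G H : {set {set U}}) (x y : U) (S : {set U}).

Fixpoint zdd_family_rec D (k : nat) (v : znode D + bool) : {set {set U}} :=
  match v with
  | inr b => if b then [set set0] else set0
  | inl n => if k is k'.+1
             then zdd_family_rec k' (zlo n) :|:
                  [set zlb n |: S | S in zdd_family_rec k' (zhi n)]
             else set0
  end.

(* Labels strictly increase along arcs, so the recursion depth #|U| is never  *)
(* exhausted: see zdd_familyE for the defining equation.                      *)
Definition zdd_family D (v : znode D + bool) : {set {set U}} := zdd_family_rec #|U| v.

Definition represents D F := zdd_family (zroot D) = F.

(* A normal form of the two reduction rules: no two nodes can be merged, and  *)
(* no node can be deleted.                                                    *)
Definition reduced D :=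
  (forall n1 n2 : znode D,
     zlb n1 = zlb n2 -> zlo n1 = zlo n2 -> zhi n1 = zhi n2 -> n1 = n2) /\
  (forall n : znode D, zhi n <> inr false).

(* Both terminals are counted, whether or not they are reachable.             *)
Definition num_nodes D : nat := #|znode D| + 2.

Let depth D (v : znode D + bool) : nat :=
  if v is inl n then #|[set x | (zlb n <= x)%O]| else 0.

Let depth_arc D (n : znode D) (c : znode D + bool) :
  arc (@zlo _ _ D) (@zhi _ _ D) (inl n) c -> depth c < depth (inl n).
Proof.
case: c => [c|b] e /=; last by apply/card_gt0P; exists (zlb n); rewrite inE.
have ltnc := zdd_ordered e.
apply: proper_card; apply/properP; split.
  by apply/subsetP => x; rewrite !inE => /(lt_le_trans ltnc)/ltW.
by exists (zlb n); rewrite !inE ?lexx // -ltNge.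
Qed.

Let arc_lo D (n : znode D) : arc (@zlo _ _ D) (@zhi _ _ D) (inl n) (zlo n).
Proof. by rewrite /= eqxx. Qed.

Let arc_hi D (n : znode D) : arc (@zlo _ _ D) (@zhi _ _ D) (inl n) (zhi n).
Proof. by rewrite /= eqxx orbT. Qed.

Let depth_lo D (n : znode D) : depth (zlo n) < depth (inl n).
Proof. exact/depth_arc/arc_lo. Qed.

Let depth_hi D (n : znode D) : depth (zhi n) < depth (inl n).
Proof. exact/depth_arc/arc_hi. Qed.

Let family_recE D k l (v : znode D + bool) :
  depth v <= k -> depth v <= l -> zdd_family_rec k v = zdd_family_rec l v.
Proof.
elim: k l v => [|k IH] l [n|b] //.
- by move/(leq_trans (depth_lo n)).
- by case: l.
- case: l => [_ /(leq_trans (depth_lo n))//|l] dk dl /=.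
  rewrite (IH l (zlo n)) ?(IH l (zhi n)) // -ltnS.
  + exact: leq_trans (depth_hi n) dk.
  + exact: leq_trans (depth_hi n) dl.
  + exact: leq_trans (depth_lo n) dk.
  + exact: leq_trans (depth_lo n) dl.
- by case: l.
Qed.

Lemma zdd_familyE D (v : znode D + bool) :
  zdd_family v = match v with
             | inr true => [set set0]
             | inr false => set0
             | inl n => zdd_family (zlo n) :|: [set zlb n |: S | S in zdd_family (zhi n)]
             end.
Proof.
have dU w : depth w <= #|U| by case: w => //= n; exact: max_card.
case: v => [n|b]; last by rewrite /zdd_family; case: #|U| => [|?]; case: b.
rewrite /zdd_family (@family_recE _ #|U| #|U|.+1) //.
exact/leqW/dU.
Qed.

Let le_lb D (n : znode D) S x : S \in zdd_family (inl n) -> x \in S -> (zlb n <= x)%O.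
Proof.
have [k] := ubnP (depth (inl n)).
elim: k n S => // k IH n S dk; rewrite zdd_familyE inE.
have sub c T : arc (@zlo _ _ D) (@zhi _ _ D) (inl n) c ->
    T \in zdd_family c -> x \in T -> (zlb n < x)%O.
  move=> a; case: c a => [c|b] a; last first.
    by rewrite zdd_familyE; case: b {a}; rewrite !inE // => /eqP->; rewrite inE.
  move=> Tc xT; apply: lt_le_trans (zdd_ordered a) _.
  apply: IH Tc xT; exact: leq_trans (depth_arc a) dk.
case/orP => [SF xS|/imsetP[T TF ->]]; first exact/ltW/(sub _ _ (arc_lo n) SF).
rewrite in_setU1 => /predU1P[->//|xT]; exact/ltW/(sub _ _ (arc_hi n) TF).
Qed.

Let lb_notin D (n : znode D) c S : arc (@zlo _ _ D) (@zhi _ _ D) (inl n) c ->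
  S \in zdd_family c -> zlb n \notin S.
Proof.
case: c => [c|b] a; last first.
  by rewrite zdd_familyE; case: b {a}; rewrite !inE // => /eqP->; rewrite inE.
by move=> Sc; apply/negP => /(le_lb Sc); rewrite leNgt (zdd_ordered a).
Qed.

Definition lo_cofactor x F : {set {set U}} := [set S in F | x \notin S].
Definition hi_cofactor x F : {set {set U}} := [set S :\ x | S in F & x \in S].

Lemma family_lo D (n : znode D) : zdd_family (zlo n) = lo_cofactor (zlb n) (zdd_family (inl n)).
Proof.
apply/setP => S; rewrite inE [zdd_family (inl n)]zdd_familyE inE.
apply/idP/andP => [SF|[/orP[//|/imsetP[T _ ->]]]]; last by rewrite setU11.
by rewrite SF (lb_notin (arc_lo n) SF).
Qed.

Lemma family_hi D (n : znode D) : zdd_family (zhi n) = hi_cofactor (zlb n) (zdd_family (inl n)).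
Proof.
apply/setP => S; apply/idP/imsetP => [SF|[T]].
  exists (zlb n |: S); last by rewrite setU1K // (lb_notin (arc_hi n) SF).
  by rewrite inE setU11 andbT zdd_familyE inE imset_f ?orbT.
rewrite inE zdd_familyE inE => /andP[/orP[TF|/imsetP[V VF ->]] xT ->].
  by rewrite (negPf (lb_notin (arc_lo n) TF)) in xT.
by rewrite setU1K // (lb_notin (arc_hi n) VF).
Qed.

Let cofactorK x F : F = lo_cofactor x F :|: [set x |: S | S in hi_cofactor x F].
Proof.
apply/setP => S; rewrite !inE; apply/idP/orP => [SF|[/andP[]//|]].
  have [xS|xS] := boolP (x \in S); last by left; rewrite SF.
  right; apply/imsetP; exists (S :\ x); last by rewrite setD1K.
  by apply/imsetP; exists S; rewrite // inE SF.
by case/imsetP => T /imsetP[V]; rewrite inE => /andP[VF xV] -> ->; rewrite setD1K.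
Qed.

Let reduced_family0 D (v : znode D + bool) :
  reduced D -> zdd_family v = set0 -> v = inr false.
Proof.
case=> _ hiD; have [k] := ubnP (depth v); elim: k v => // k IH [n|[]//] dk.
  rewrite zdd_familyE => /eqP; rewrite setU_eq0 imset_eq0 => /andP[_ /eqP h0].
  case: (hiD n); apply: IH h0; exact: leq_trans (depth_hi n) dk.
by move=> /setP/(_ set0); rewrite zdd_familyE !inE eqxx.
Qed.

Let reduced_lb D (n : znode D) :
  reduced D -> exists2 S, S \in zdd_family (inl n) & zlb n \in S.
Proof.
move=> rD; have [h0|/set0Pn[S SF]] := eqVneq (zdd_family (zhi n)) set0.
  by case: (rD) => _ /(_ n); case; exact: reduced_family0 h0.
by exists (zlb n |: S); rewrite ?setU11 // zdd_familyE inE imset_f ?orbT.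
Qed.

Let reduced_family_inj D : reduced D -> injective (@zdd_family D).
Proof.
move=> rD v w; have [k] := ubnP (depth v); elim: k v w => // k IH.
have term b (n : znode D) : zdd_family (inr b : znode D + bool) <> zdd_family (inl n).
  move=> E; have [S] := reduced_lb n rD.
  by rewrite -E zdd_familyE; case: b {E}; rewrite !inE // => /eqP->; rewrite inE.
move=> [n|b] [m|c] dk.
- move=> E; have [S SF nS] := reduced_lb n rD; have [T TF mT] := reduced_lb m rD.
  have lbE : zlb n = zlb m.
    apply/eqP; rewrite eq_le (@le_lb _ n T) ?E //=.
    by apply: (@le_lb _ m S); rewrite -?E.
  congr inl; case: (rD) => + _; apply=> //; apply: IH.
  + exact: leq_trans (depth_lo n) dk.
  + by rewrite !family_lo E lbE.
  + exact: leq_trans (depth_hi n) dk.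
  + by rewrite !family_hi E lbE.
- by move/esym/term.
- by move/term.
- rewrite !zdd_familyE; case: b {dk}; case: c => // /setP/(_ set0).
  + by rewrite !inE eqxx.
  + by rewrite !inE eqxx.
Qed.

Lemma reduced_minimal D D' F :
  reduced D -> represents D F -> represents D' F -> num_nodes D <= num_nodes D'.
Proof.
move=> rD FD FD'; rewrite leq_add2r.
have skip x (w : znode D' + bool) :
    (exists2 S, S \in zdd_family w & x \in S) ->
    (forall S y, S \in zdd_family w -> y \in S -> (x <= y)%O) ->
    exists2 m : znode D', zlb m = x & zdd_family (inl m) = zdd_family w.
  have [k] := ubnP (depth w); elim: k w => // k IH [m|b] dk [S Sw xS] xmin.
    have [<-|neq] := eqVneq (zlb m) x; first by exists m.
    have lt_mx : (zlb m < x)%O by rewrite lt_neqAle neq (le_lb Sw xS).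
    have E : zdd_family (inl m) = zdd_family (zlo m).
      apply/setP => T; rewrite family_lo inE; case TF: (T \in _) => //=.
      by apply/esym/negP => /(xmin _ _ TF); rewrite leNgt lt_mx.
    case: (IH (zlo m)).
    - exact: leq_trans (depth_lo m) dk.
    - by exists S; rewrite -?E.
    - by move=> T y; rewrite -E; exact: xmin.
    by move=> m' <- Em'; exists m'; rewrite // Em'.
  by move: Sw xS; rewrite zdd_familyE; case: b {dk xmin};
    rewrite !inE // => /eqP->; rewrite inE.
have match_node (n : znode D) (w : znode D' + bool) : zdd_family w = zdd_family (inl n) ->
    exists2 m : znode D', zlb m = zlb n & zdd_family (inl m) = zdd_family (inl n).
  by move=> E; rewrite -E; apply: skip; rewrite E;
    [exact: reduced_lb|exact: le_lb].
have match_ref (v : znode D + bool) : connect (arc (@zlo _ _ D) (@zhi _ _ D)) (zroot D) v ->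
    exists w : znode D' + bool, zdd_family w = zdd_family v.
  move=> /connectP[p + ->] {v}; elim/last_ind: p => [|p v IH].
    by move=> _; exists (zroot D'); rewrite FD FD'.
  rewrite rcons_path last_rcons => /andP[/IH[w]].
  case: (last _ _) => // n /match_node[m lbm Em] /= /orP[]/eqP->.
    by exists (zlo m); rewrite !family_lo Em lbm.
  by exists (zhi m); rewrite !family_hi Em lbm.
have match_D (n : znode D) : exists m : znode D', zdd_family (inl m) = zdd_family (inl n).
  by have [w /match_node[m _]] := match_ref _ (zdd_rooted n); exists m.
have {match_D}[f fE] := choice match_D.
rewrite -(card_codom (f := f)) ?max_card // => n m E.
by have /(reduced_family_inj rD)[] : zdd_family (inl n) = zdd_family (inl m) by rewrite -!fE E.
Qed.

Lemma reduced_unique_size D D' F : reduced D -> represents D F ->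
  reduced D' -> represents D' F -> num_nodes D = num_nodes D'.
Proof.
move=> rD FD rD' FD'; apply/eqP; rewrite eqn_leq.
by rewrite (reduced_minimal rD FD FD') (reduced_minimal rD' FD' FD).
Qed.

Section Existence.
Variable F0 : {set {set U}}.

Let top F : option U :=
  [pick x | (x \in cover F) && [forall y in cover F, (x <= y)%O]].

Let topP F x : top F = Some x ->
  x \in cover F /\ (forall y, y \in cover F -> (x <= y)%O).
Proof.
rewrite /top; case: pickP => // z /andP[zF /forall_inP zmin] [<-].
by split.
Qed.

Let topN F : top F = None -> cover F = set0.
Proof.
rewrite /top; case: pickP => // none _; apply/eqP/set0Pn => -[x xF].
case: (arg_minP id xF) => z zF zmin.
have /= := none z; have -> /= : z \in cover F by [].
by move/negP; case; apply/forall_inP => y /zmin.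
Qed.

Let cof : rel {set {set U}} := fun F G =>
  if top F is Some x then (G == lo_cofactor x F) || (G == hi_cofactor x F)
  else false.

Let cnode : predArgType :=
  {p : U * {set {set U}} | (top p.2 == Some p.1) && connect cof F0 p.2}.

Let cref F : cnode + bool :=
  if top F is Some x then
    if insub (x, F) is Some n then inl n else inr false
  else inr (set0 \in F).

Let clb (n : cnode) : U := (val n).1.
Let cfam (n : cnode) : {set {set U}} := (val n).2.
Let clo (n : cnode) : cnode + bool := cref (lo_cofactor (clb n) (cfam n)).
Let chi (n : cnode) : cnode + bool := cref (hi_cofactor (clb n) (cfam n)).

Let top_cfam n : top (cfam n) = Some (clb n).
Proof. by case: n => -[x F] /= i; case/andP: (i) => /eqP. Qed.

Let conn_cfam n : connect cof F0 (cfam n).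
Proof. by case: n => -[x F] /= i; case/andP: (i). Qed.

Let cref_inl F n : cref F = inl n -> cfam n = F.
Proof.
rewrite /cref; case: top => // x; case: insubP => // m _ E [<-].
by rewrite /cfam E.
Qed.

Let cref_Some F x : connect cof F0 F -> top F = Some x ->
  exists n, [/\ cref F = inl n, cfam n = F & clb n = x].
Proof.
move=> cF tF; rewrite /cref tF; case: insubP => [n _ E|].
  by exists n; rewrite /cfam /clb E.
by rewrite /= tF eqxx cF.
Qed.

Let cover_cof n y F : F = lo_cofactor (clb n) (cfam n) \/ F = hi_cofactor (clb n) (cfam n) ->
  y \in cover F -> (y \in cover (cfam n)) && (y != clb n).
Proof.
case=> -> /bigcupP[S]; rewrite ?inE.
  move=> /andP[SF xS] yS; apply/andP; split; first by apply/bigcupP; exists S.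
  by apply: contraNneq xS => <-.
case/imsetP=> T; rewrite inE => /andP[TF xT] ->; rewrite !inE => /andP[-> yT].
by rewrite andbT; apply/bigcupP; exists T.
Qed.

Let carc n v : arc clo chi (inl n) v -> exists2 F,
  F = lo_cofactor (clb n) (cfam n) \/ F = hi_cofactor (clb n) (cfam n) & v = cref F.
Proof.
by case/orP=> /eqP->; [exists (lo_cofactor (clb n) (cfam n))
                      |exists (hi_cofactor (clb n) (cfam n))]; auto.
Qed.

Let cordered n c : arc clo chi (inl n) (inl c) -> (clb n < clb c)%O.
Proof.
case/carc=> F FE /esym/cref_inl cF.
have [lbc _] := topP (top_cfam c); rewrite cF in lbc.
have /andP[lbn neq] := cover_cof FE lbc.
by rewrite lt_neqAle eq_sym neq; have [_] := topP (top_cfam n); apply.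
Qed.

Let cref_connect F : connect cof F0 F -> connect (arc clo chi) (cref F0) (cref F).
Proof.
move=> /connectP[p + ->]; elim/last_ind: p => [|p G IH]; first by rewrite connect0.
rewrite rcons_path last_rcons => /andP[pp].
have cl : connect cof F0 (last F0 p) by apply/connectP; exists p.
rewrite /cof; case tl: top => [x|//] GE; apply: connect_trans (IH pp) _.
have [n [-> nF nx]] := cref_Some cl tl.
apply: connect1; rewrite /arc /clo /chi nF nx.
by case/orP: GE => /eqP->; rewrite eqxx ?orbT.
Qed.

Let crooted (n : cnode) : connect (arc clo chi) (cref F0) (inl n).
Proof.
have := cref_connect (conn_cfam n).
have [m [-> mF mx]] := cref_Some (conn_cfam n) (top_cfam n).
suff -> : m = n by [].
by apply: val_inj; rewrite [val m]surjective_pairing [val n]surjective_pairing;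
  congr pair.
Qed.

Let czdd : zdd U := ZDD cordered crooted.

Let conn_lo n : connect cof F0 (lo_cofactor (clb n) (cfam n)).
Proof.
by apply: connect_trans (conn_cfam n) (connect1 _); rewrite /cof top_cfam eqxx.
Qed.

Let conn_hi n : connect cof F0 (hi_cofactor (clb n) (cfam n)).
Proof.
by apply: connect_trans (conn_cfam n) (connect1 _);
  rewrite /cof top_cfam eqxx orbT.
Qed.

Let cover0 F : cover F = set0 -> F = if set0 \in F then [set set0] else set0.
Proof.
move=> c0; have F0s S : S \in F -> S = set0.
  by move=> SF; apply/eqP; rewrite -subset0 -c0 bigcup_sup.
apply/setP => S; case: ifP => F0in; rewrite !inE.
  by apply/idP/eqP => [/F0s|->].
by apply/negP => SF; rewrite -(F0s _ SF) SF in F0in.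
Qed.

Let family_cref F : connect cof F0 F -> zdd_family (cref F : znode czdd + bool) = F.
Proof.
have [k] := ubnP #|cover F|; elim: k F => // k IH F dk cF.
case tF: (top F) => [x|]; last first.
  by rewrite /cref tF [RHS](cover0 (topN tF)) zdd_familyE; case: (_ \in _).
have [n [-> nF nx]] := cref_Some cF tF.
have lt_cof G : G = lo_cofactor (clb n) (cfam n) \/ G = hi_cofactor (clb n) (cfam n) ->
    #|cover G| < k.
  move=> GE; apply: leq_trans (_ : #|cover F| <= k); last by rewrite -ltnS.
  apply: proper_card; apply/properP; rewrite -nF; split.
    by apply/subsetP => y /(cover_cof GE)/andP[].
  have [lbn _] := topP (top_cfam n); exists (clb n) => //.
  by apply/negP => /(cover_cof GE); rewrite eqxx andbF.
rewrite zdd_familyE.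
rewrite -[zlo _]/(clo n) -[zhi _]/(chi n) -[zlb _]/(clb n) /clo /chi.
rewrite !IH ?conn_lo ?conn_hi //; last 2 first.
  by apply: lt_cof; right.
  by apply: lt_cof; left.
by rewrite -cofactorK nF.
Qed.

Let family_cnode (n : znode czdd) : zdd_family (inl n) = cfam n.
Proof.
rewrite zdd_familyE -[zlo _]/(clo n) -[zhi _]/(chi n) -[zlb _]/(clb n) /clo /chi.
by rewrite !family_cref ?conn_lo ?conn_hi // -cofactorK.
Qed.

Lemma reduced_zdd_exists : exists D, reduced D /\ represents D F0.
Proof.
exists czdd; split; last exact/family_cref/connect0.
split=> [n m lbE loE hiE|n hi0].
  apply: val_inj; rewrite [val n]surjective_pairing [val m]surjective_pairing.
  congr pair; first exact: lbE.
  rewrite -[LHS]/(cfam n) -[RHS]/(cfam m) -!family_cnode.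
  by rewrite zdd_familyE [RHS]zdd_familyE lbE loE hiE.
have [/bigcupP[S SF xS] _] := topP (top_cfam n).
have : S :\ clb n \in hi_cofactor (clb n) (cfam n) by apply/imsetP; exists S; rewrite // inE SF.
rewrite -(family_cref (conn_hi n)) -[cref _]/(zhi (n : znode czdd)) hi0.
by rewrite zdd_familyE inE.
Qed.

End Existence.

(* The chosen reduced ZDD is immaterial by reduced_unique_size.               *)
Definition reduced_zdd F : zdd U := projT1 (cid (reduced_zdd_exists F)).

Lemma reduced_zddP F : reduced (reduced_zdd F) /\ represents (reduced_zdd F) F.
Proof. exact: projT2 (cid (reduced_zdd_exists F)). Qed.

Definition zdd_size F : nat := num_nodes (reduced_zdd F).

End ZDD.

(* Main.v *)
Require Import Defs.
From mathcomp Require Import all_boot all_order zify.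
Import Order.TTheory.

Set Implicit Arguments.
Unset Strict Implicit.
Unset Printing Implicit Defensive.

(* The size of a reduced ZDD is governed by the numbers of cofactors
   {T | P :|: T \in F} with P ranging over the sets of variables below x and T
   consisting of variables above x.  Order 3m variables as
   s_1 < ... < s_m < x_1 < ... < x_m < y_1 < ... < y_m and let F be the family
   of all sets containing exactly one selector s_i and, for this i, both x_i
   and y_i; knowing s_i, only one index has to be tracked, so F has O(m)
   cofactors at each variable.  A suitable G (all sets of selectors or, for the
   meet, the single set of all non-selectors) makes the operation erase which
   selector was used: fixing all selectors to be present (absent for the meet)
   in the result leaves the sets that contain x_i and y_i for some i.  Each of
   the 2^m sets of x-variables then gives a different cofactor at y_1. *)

(** * Cofactors of a family and nodes of its reduced ZDD *)

Section Cofactors.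
Context {d : Order.disp_t} {U : finOrderType d}.
Implicit Types (D : zdd U) (F : {set {set U}}) (x y : U) (P S T : {set U}).

Definition below x : {set U} := [set y | (y < x)%O].
Definition above x : {set U} := [set y | (x <= y)%O].

Definition cofactor x P F := [set T in powerset (above x) | P :|: T \in F].
Definition cofactors x F := [set cofactor x P F | P in powerset (below x)].

Local Notation zarc D := (Defs.arc (@zlo _ _ D) (@zhi _ _ D)).

Lemma vertex_ind D (K : znode D + bool -> Prop) :
  (forall b, K (inr b)) ->
  (forall n, (forall v, zarc D (inl n) v -> K v) -> K (inl n)) ->
  forall v, K v.
Proof.
move=> Kterm Knode [n|//].
have [k] := ubnP #|above (zlb n)|; elim: k n => // k IH n lenk.
apply: Knode => -[m|//] /zdd_ordered lt_nm; apply: IH.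
rewrite ltnS in lenk; apply: leq_trans lenk; apply/proper_card/properP.
split; first by apply/subsetP => x; rewrite !inE; exact/le_trans/ltW.
by exists (zlb n); rewrite !inE // -ltNge.
Qed.

Lemma zdd_familyP D (n : znode D) S :
  reflect (S \in zdd_family (zlo n) \/
           exists2 T, T \in zdd_family (zhi n) & S = zlb n |: T)
          (S \in zdd_family (inl n)).
Proof.
rewrite [zdd_family (inl n)]zdd_familyE inE; apply: (iffP orP) => -[]; auto.
  by case/imsetP => T; right; exists T.
by case=> T TF ->; right; apply: imset_f.
Qed.

Lemma arc_family_gt D n v S x :
  zarc D (inl n) v -> S \in zdd_family v -> x \in S -> (zlb n < x)%O.
Proof.
elim/vertex_ind: v n S => [b|m IH] n S nv.
  by rewrite zdd_familyE; case: b {nv}; rewrite ?inE // => /eqP->; rewrite inE.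
have lt_nm := zdd_ordered nv.
have sub v T : zarc D (inl m) v -> T \in zdd_family v -> x \in T -> (zlb n < x)%O.
  by move=> mv Tv xT; apply: lt_trans lt_nm (IH v mv m T mv Tv xT).
case/zdd_familyP => [SF|[T TF ->]]; first by apply: sub SF; rewrite /= eqxx.
by rewrite in_setU1 => /predU1P[->//|]; apply: sub TF; rewrite /= eqxx orbT.
Qed.

Lemma arc_lo D (n : znode D) : zarc D (inl n) (zlo n).
Proof. by rewrite /= eqxx. Qed.

Lemma arc_hi D (n : znode D) : zarc D (inl n) (zhi n).
Proof. by rewrite /= eqxx orbT. Qed.

Lemma zdd_family_ge D (n : znode D) S :
  S \in zdd_family (inl n) -> S \subset above (zlb n).
Proof.
move=> Sn; apply/subsetP => x; rewrite inE; case/zdd_familyP: Sn => [SF xS|[T TF ->]].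
  exact/ltW/(arc_family_gt (arc_lo n) SF).
by rewrite in_setU1 => /predU1P[->//|xT]; apply/ltW/(arc_family_gt (arc_hi n) TF).
Qed.

(** As [T] lies above [x], no [P :|: T] contains [zlb n], so passing to the lo-child loses
    nothing. *)
Lemma cofactor_lo D (n : znode D) x P : (zlb n < x)%O -> zlb n \notin P ->
  cofactor x P (zdd_family (zlo n)) = cofactor x P (zdd_family (inl n)).
Proof.
move=> lt_nx nP; apply/setP => T; rewrite !inE family_lo inE.
have [/subsetP Tx|//] := boolP (T \subset _).
rewrite in_setU (negPf nP) /=.
have [/Tx|_] := boolP (zlb n \in T); last by rewrite andbT.
by rewrite inE leNgt lt_nx.
Qed.

Lemma cofactor_hi D (n : znode D) x P : (zlb n < x)%O -> zlb n \notin P ->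
  cofactor x P (zdd_family (zhi n)) = cofactor x (zlb n |: P) (zdd_family (inl n)).
Proof.
move=> lt_nx nP; apply/setP => T; rewrite !inE.
have [/subsetP Tx|//] := boolP (T \subset _).
have nPT : zlb n \notin P :|: T.
  rewrite in_setU (negPf nP) /=; apply/negP => /Tx.
  by rewrite inE leNgt lt_nx.
rewrite -setUA /=; apply/idP/idP => [PTF|].
  by apply/zdd_familyP; right; exists (P :|: T).
rewrite family_hi => PTF; apply/imsetP; exists (zlb n |: (P :|: T)).
  by rewrite inE PTF setU11.
by rewrite setU1K.
Qed.

(** Walk down from [v]: when the label lies in [P], remove it and take the hi-arc; otherwise take
    the lo-arc. Stop at a terminal or once the label reaches [x]. *)
Lemma cofactor_vertex D (v : znode D + bool) x P : P \subset below x ->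
  exists w : znode D + bool, zdd_family w = cofactor x P (zdd_family v).
Proof.
elim/vertex_ind: v P => [b|n IH] P Px.
  exists (inr (b && (P == set0))); rewrite !zdd_familyE; apply/setP => T.
  case: b; rewrite !inE ?andbF //=.
  rewrite setU_eq0; case: (P =P set0) => _; rewrite ?inE /= ?andbF //.
  by case: eqP => [->|]; rewrite ?sub0set ?andbF.
have [lt_nx|le_xn] := ltP (zlb n) x.
  have [nP|nP] := boolP (zlb n \in P); last first.
    by have [w] := IH _ (arc_lo n) P Px; rewrite cofactor_lo //; exists w.
  have [|w] := IH _ (arc_hi n) (P :\ zlb n); first exact: subset_trans (subD1set _ _) Px.
  by rewrite cofactor_hi ?setD11 // setD1K //; exists w.
(* If [P] is used up, the node itself represents the cofactor. A leftover element of [P] is smaller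
   than every remaining label, occurs in no member, and makes the cofactor empty. *)
have [->|/set0Pn[y yP]] := eqVneq P set0.
  exists (inl n); apply/setP => T; rewrite !inE set0U.
  have [TF|] := boolP (T \in _); rewrite ?andbF // andbT; apply/esym.
  apply/subsetP => y /(subsetP (zdd_family_ge TF)); rewrite !inE.
  exact: le_trans.
exists (inr false); apply/setP => T; rewrite zdd_familyE !inE.
apply/esym/andP => -[_ /zdd_family_ge/subsetP/(_ y)].
rewrite !inE yP => /(_ isT) le_ny.
by move: (subsetP Px _ yP); rewrite inE ltNge (le_trans le_xn le_ny).
Qed.

(** Distinct cofactors need distinct vertices by [cofactor_vertex]; terminals are among the counted
    vertices. *)
Lemma card_cofactors_le_zdd_size x F : #|cofactors x F| <= zdd_size F.
Proof.
have [_ DF] := reduced_zddP F; rewrite /zdd_size.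
move: (reduced_zdd F) DF => D DF.
rewrite /num_nodes.
have <- : #|[set: znode D + bool]| = #|znode D| + 2 by rewrite cardsT card_sum card_bool.
apply: leq_trans (leq_imset_card (@zdd_family _ _ D) _).
apply/subset_leq_card/subsetP => C /imsetP[P]; rewrite inE => Px ->.
have [w wE] := cofactor_vertex (zroot D) Px.
by apply/imsetP; exists w; rewrite // wE DF.
Qed.

(* The bound by the labels of the parents of v keeps the label of a parent out
   of P, where cofactor_lo and cofactor_hi would fail. *)
Lemma connect_cofactor D v n : connect (zarc D) v (inl n) ->
  exists P, [/\ P \subset below (zlb n),
    forall k, zarc D (inl k) v -> {in zlb n |: P, forall y, (zlb k < y)%O} &
    zdd_family (inl n) = cofactor (zlb n) P (zdd_family v)].
Proof.
case/connectP => p; elim: p v => [|v p IH] u /=.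
  move=> _ <-; exists set0; rewrite sub0set; split=> //.
    move=> k kn y; rewrite in_setU1 inE orbF => /eqP ->; exact: zdd_ordered kn.
  apply/setP => T; rewrite !inE set0U.
  by have [/zdd_family_ge->|] := boolP (T \in _); rewrite ?andbF.
case/andP; case: u => // m mv pv nE; have [P [Pn gtP fE]] := IH v pv nE.
have nP : zlb m \notin P.
  by apply/negP => mP; have := gtP m mv (zlb m); rewrite setU1r // ltxx => /(_ isT).
have lt_mn : (zlb m < zlb n)%O by apply: gtP mv _ _; rewrite setU11.
have {mv} [vE|vE] : v = zlo m \/ v = zhi m by case/orP: (mv) => /eqP; auto.
- exists P; split => //; last by rewrite fE vE cofactor_lo.
  move=> k /zdd_ordered lt_km y yP; apply: lt_trans lt_km _.
  by apply: gtP yP; rewrite vE arc_lo.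
- exists (zlb m |: P); split => //; last by rewrite fE vE cofactor_hi.
    by rewrite subUset Pn andbT sub1set inE.
  move=> k /zdd_ordered lt_km y; rewrite setUCA in_setU1 => /predU1P[->//|yP].
  by apply: lt_trans lt_km _; apply: gtP yP; rewrite vE arc_hi.
Qed.

(** Hi-arcs of a reduced diagram never lead to bottom, so following them ends at top and spells out
    a member. *)
Lemma reduced_hi_mem D (n : znode D) : reduced D ->
  exists2 S, S \in zdd_family (inl n) & zlb n \in S.
Proof.
move=> [_ hiD].
have nonempty (v : znode D + bool) : v <> inr false -> exists S, S \in zdd_family v.
  elim/vertex_ind: v => [[]// _|m IH _]; first by exists set0; rewrite zdd_familyE inE.
  have [S SF] := IH _ (arc_hi m) (hiD m).
  by exists (zlb m |: S); apply/zdd_familyP; right; exists S.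
have [S SF] := nonempty _ (hiD n).
by exists (zlb n |: S); rewrite ?setU11 //; apply/zdd_familyP; right; exists S.
Qed.

(** The family of a node determines the label, as the least element occurring in a member, and then
    the children, as its lo- and hi-cofactors. *)
Lemma reduced_family_inj D : reduced D -> injective (@zdd_family _ _ D).
Proof.
move=> rD v; elim/vertex_ind: v => [b|n IH].
  move=> [m|c].
    have [S Sm mS] := reduced_hi_mem m rD.
    move=> E; move: Sm; rewrite -E zdd_familyE.
    by case: b {E} => //; rewrite !inE // => /eqP S0; rewrite S0 inE in mS.
  by rewrite !zdd_familyE; case: b; case: c => // /setP/(_ set0); rewrite !inE eqxx.
have [S Sn nS] := reduced_hi_mem n rD.
move=> [m|c] E; last first.
  move: Sn; rewrite E zdd_familyE.
  by case: c {E} => //; rewrite !inE // => /eqP S0; rewrite S0 inE in nS.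
have [T Tm mT] := reduced_hi_mem m rD.
have lbE : zlb n = zlb m.
  apply/le_anti/andP; split.
    by rewrite -E in Tm; have /subsetP/(_ _ mT) := zdd_family_ge Tm; rewrite inE.
  by rewrite E in Sn; have /subsetP/(_ _ nS) := zdd_family_ge Sn; rewrite inE.
congr inl; case: (rD) => + _; apply => //.
  by apply: (IH _ (arc_lo n)); rewrite !family_lo E lbE.
by apply: (IH _ (arc_hi n)); rewrite !family_hi E lbE.
Qed.

(** Nodes labelled [x] have distinct families, each a cofactor of [F] at [x]; the nodes are counted
    label by label. *)
Lemma zdd_size_le_cofactors F :
  zdd_size F <= \sum_x #|cofactors x F| + 2.
Proof.
have [rD DF] := reduced_zddP F; rewrite /zdd_size.
move: (reduced_zdd F) rD DF => D rD DF; rewrite leq_add2r.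
rewrite -sum1_card (partition_big (@zlb _ _ D) predT) //=.
apply: leq_sum => x _; rewrite sum1dep_card.
rewrite -(card_imset _ (inj_comp (reduced_family_inj rD) (@inl_inj _ _))).
apply/subset_leq_card/subsetP => C /imsetP[n]; rewrite inE => /eqP <- ->.
rewrite /=; have [P [Pn _ ->]] := connect_cofactor (zdd_rooted n).
by rewrite DF; apply: imset_f; rewrite inE.
Qed.

End Cofactors.

(** * Cofactors of unions of intervals in the Boolean lattice *)

Section IntervalFamilies.
Context {d : Order.disp_t} {U : finOrderType d} {I : finType}.
Implicit Types (L M : I -> {set U}) (x : U) (P T : {set U}).

Definition interval_union L M : {set {set U}} :=
  [set B : {set U} | [exists i, (L i \subset B) && (B \subset M i)]].

(* The cofactor of P at x depends only on the intervals that P can still reach. *)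
Definition alive L M x P : {set I} :=
  [set i | (L i :&: below x \subset P) && (P \subset M i)].

Lemma card_cofactors_interval_union L M x (Q : {set {set I}}) :
  (forall P, P \subset below x -> alive L M x P \in Q) ->
  #|cofactors x (interval_union L M)| <= #|Q|.
Proof.
move=> Qalive.
(* [g] rebuilds the cofactor from the alive indices, since each interval condition splits into a
   part on [P] and a part on [T]. *)
pose g (A : {set I}) := [set T in powerset (above x) |
  [exists i in A, (L i :&: above x \subset T) && (T \subset M i)]].
apply: leq_trans (leq_imset_card g Q).
apply/subset_leq_card/subsetP => C /imsetP[P]; rewrite inE => Px ->.
apply/imsetP; exists (alive L M x P); first exact: Qalive.
apply/setP => T; rewrite !inE; have [Tx|//] := boolP (T \subset _) => /=.
have disj y : y \in below x -> y \in above x -> False.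
  by rewrite !inE => lt_yx; rewrite leNgt lt_yx.
apply: eq_existsb => i; rewrite !inE subUset.
have -> : (L i \subset P :|: T) =
    (L i :&: below x \subset P) && (L i :&: above x \subset T).
  apply/subsetP/andP => [LPT|[/subsetP LP /subsetP LT] y Ly].
    split; apply/subsetP => y /setIP[/LPT/setUP[] // yPT yx].
      by case: (disj y yx (subsetP Tx _ yPT)).
    by case: (disj y (subsetP Px _ yPT) yx).
  rewrite inE; have [lt_yx|le_xy] := ltP y x.
    by rewrite LP // !inE Ly lt_yx.
  by rewrite LT ?orbT // !inE Ly le_xy.
by rewrite andbACA andbA.
Qed.

End IntervalFamilies.

Lemma card_cofactors_interval d (U : finOrderType d) (L M : {set U}) (x : U) :
  #|cofactors x (interval_union (fun _ : unit => L) (fun _ => M) : {set {set U}})| <= 2.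
Proof.
apply: leq_trans (card_cofactors_interval_union (I := unit) (Q := powerset setT) _) _.
  by move=> P _; rewrite inE subsetT.
by rewrite card_powerset cardsT card_unit.
Qed.


(** * The hard instance *)

Section Construction.
Variable m : nat.
Local Notation U := ('I_3 *l 'I_m)%type.
Implicit Types (i j : 'I_m) (u x : U) (A B P : {set U}).

(** The lexicographic order compares the ['I_3] component first, so the three blocks follow one
    another. *)
Definition sel i : U := (ord0, i).
Definition mid i : U := (Ordinal (isT : 1 < 3), i).
Definition bot i : U := (ord_max, i).

Definition selectors : {set U} := [set sel i | i : 'I_m].

Definition matching : {set {set U}} :=
  interval_union (fun i => [set sel i; mid i; bot i]) (fun i => sel i |: ~: selectors).

Definition partner (op : family_op) : {set {set U}} :=
  if op is Meet then interval_union (fun _ : unit => ~: selectors) (fun _ => ~: selectors)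
  else interval_union (fun _ : unit => set0) (fun _ => selectors).

Lemma sel_selectors i : sel i \in selectors.
Proof. exact: imset_f. Qed.

Lemma mid_selectors i : mid i \in selectors = false.
Proof. by apply/imsetP => -[]. Qed.

Lemma bot_selectors i : bot i \in selectors = false.
Proof. by apply/imsetP => -[]. Qed.

Lemma lt_sel u i : (u < sel i)%O -> u \in selectors.
Proof.
case: u => a j; rewrite Order.ProdLexiOrder.ltEprodlexi /= => /andP[a0 _].
by apply/imsetP; exists j; rewrite //; congr (_, _); apply/val_inj/eqP; rewrite -leqn0.
Qed.

(** For nonempty [P], an alive index has its selector in [P], while the upper end [M i] admits a
    single selector; so at most one index is alive. This leaves [m] singletons, the empty set and
    the value at [P = set0]. *)
Lemma card_cofactors_matching (x : U) : #|cofactors x matching| <= m + 2.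
Proof.
set L := fun i => [set sel i; mid i; bot i].
set M := fun i => sel i |: ~: selectors.
pose Q := alive L M x set0 |: (set0 |: [set [set i] | i : 'I_m]).
have sel_M u i : u \in selectors -> u \in M i -> u = sel i.
  by move=> uS; rewrite !inE uS orbF => /eqP.
apply: leq_trans (card_cofactors_interval_union (Q := Q) _) _; last first.
  rewrite /Q !cardsU1 card_imset ?card_ord; last exact: set1_inj.
  by rewrite addnA addnC leq_add2l (leq_add (leq_b1 _) (leq_b1 _)).
move=> P Px; have [->|/set0Pn[u uP]] := eqVneq P set0; first by rewrite setU11.
rewrite in_setU1; apply/orP; right; rewrite in_setU1.
have [//|/set0Pn[i iA]] := eqVneq (alive L M x P) set0; apply/imsetP; exists i => //.
(* If [sel j] is not below [x], then [u] precedes it and is itself a selector, and [u \in M j]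
   forces [u = sel j]. *)
have selP j : j \in alive L M x P -> sel j \in P.
  rewrite inE => /andP[/subsetP LP /subsetP PM].
  have [lt_jx|le_xj] := ltP (sel j) x; first by apply: LP; rewrite !inE eqxx lt_jx.
  rewrite -(sel_M u j) ?PM //; apply: (@lt_sel _ j).
  by move: (subsetP Px _ uP); rewrite inE => /lt_le_trans; apply.
apply/setP => j; rewrite inE; apply/idP/eqP => [jA|->//].
move: (iA); rewrite inE => /andP[_ /subsetP/(_ _ (selP j jA))].
by move/(sel_M _ _ (sel_selectors j)) => [].
Qed.

Lemma matchingP B :
  reflect (exists i, [/\ sel i \in B, mid i \in B, bot i \in B &
                        B \subset sel i |: ~: selectors])
          (B \in matching).
Proof.
rewrite inE; apply: (iffP existsP) => -[i].
  rewrite subUset subUset !sub1set -!andbA => /and4P[sB mB bB BM].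
  by exists i.
by case=> sB mB bB BM; exists i; rewrite subUset subUset !sub1set sB mB bB.
Qed.

Definition residue (op : family_op) : {set U} :=
  if op is Meet then set0 else selectors.

Lemma partnerP (op : family_op) B :
  (B \in partner op) =
  if op is Meet then B == ~: selectors else B \subset selectors.
Proof.
case: op; rewrite inE; apply/existsP/idP => [[_]|BS].
all: try by [case/andP|exists tt; rewrite sub0set].
  by rewrite eqEsubset andbC.
by exists tt; rewrite andbC -eqEsubset.
Qed.

(** Outside the selectors the partner leaves a member of [matching] unchanged, so its pair survives
    in [B]. Conversely, a suitable partner set turns [sel i |: B] into [residue op :|: B]. *)
Lemma matching_op (op : family_op) B : B \subset ~: selectors ->
  (residue op :|: B \in apply_op op matching (partner op)) =
  [exists i, (mid i \in B) && (bot i \in B)].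
Proof.
move=> BS; apply/idP/existsP => [opB|[i /andP[mB bB]]].
  suff [A /matchingP[i [_ mA bA _]] AB] :
      exists2 A, A \in matching & forall u, u \in A -> u \notin selectors -> u \in B.
    by exists i; rewrite !AB ?mid_selectors ?bot_selectors.
  have unionE A C u : selectors :|: B = A :|: C -> u \in A -> u \notin selectors -> u \in B.
    by move=> /setP/(_ u) + uA /negPf uS; rewrite !inE uA uS.
  case: op opB => /imset2P[A C AF].
  - by move=> _ /unionE; exists A.
  - by rewrite inE => /andP[_ _] /unionE; exists A.
  - by rewrite inE => /andP[_ _] /unionE; exists A.
  - rewrite partnerP => /eqP-> /setP E; exists A => // u uA uS.
    by move: (E u); rewrite !inE uA uS.
  - rewrite partnerP => /subsetP CS /setP E; exists A => // u uA uS.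
    have uC : u \notin C by apply: contra uS; exact: CS.
    by move: (E u); rewrite !inE uA (negPf uS) (negPf uC).
have iB : sel i |: B \in matching.
  by apply/matchingP; exists i; rewrite setU11 !setU1r ?setUS.
have iNB : sel i \notin B.
  by apply/negP => /(subsetP BS); rewrite inE sel_selectors.
have iS : [set sel i] \subset selectors by rewrite sub1set sel_selectors.
have BI0 : B :&: selectors = set0 by apply/eqP; rewrite setI_eq0 disjoints_subset.
(* Join and joint join use all selectors; disjoint join and delta leave out [sel i], which would
   intersect or cancel; the meet with the non-selectors removes [sel i]. *)
case: op; apply/imset2P.
- exists (sel i |: B) selectors; rewrite ?partnerP ?subxx //.
  by rewrite setUAC (setUidPr iS).
- exists (sel i |: B) (selectors :\ sel i) => //; last first.
    by rewrite setUAC setD1K ?sel_selectors.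
  rewrite inE partnerP subD1set /= setIDA setDE setIUl BI0 setU0 -setDE.
  by rewrite (setIidPl iS) setDv.
- exists (sel i |: B) selectors => //; last by rewrite setUAC (setUidPr iS).
  rewrite inE partnerP subxx /=; apply/set0Pn; exists (sel i).
  by rewrite !inE eqxx sel_selectors.
- exists (sel i |: B) (~: selectors); rewrite ?partnerP //.
  rewrite /= set0U setIUl (setIidPl BS) -setDE.
  by move: iS; rewrite -setD_eq0 => /eqP ->; rewrite set0U.
- exists (sel i |: B) (selectors :\ sel i); rewrite ?partnerP ?subD1set //.
  apply/setP => u; rewrite !inE; have [->|_] /= := eqVneq u (sel i).
    by rewrite sel_selectors.
  move/setP/(_ u): BI0; rewrite !inE.
  by case: (u \in selectors); case: (u \in B).
Qed.

Lemma expn_le_zdd_size_op (op : family_op) :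
  2 ^ m <= zdd_size (apply_op op matching (partner op)).
Proof.
case: (posnP m) => [m0|m_gt0].
  by rewrite {1}m0 /zdd_size /num_nodes addn2.
(* The least variable of the last block, so that all of [sel] and [mid] lies below it. *)
pose x := bot (Ordinal m_gt0).
have bot_ge j : bot j \in above x.
  by rewrite inE Order.ProdLexiOrder.leEprodlexi /=.
have sel_lt i : sel i \in below x.
  by rewrite inE Order.ProdLexiOrder.ltEprodlexi.
have mid_lt i : mid i \in below x.
  by rewrite inE Order.ProdLexiOrder.ltEprodlexi.
apply: leq_trans (card_cofactors_le_zdd_size x _).
pose P (a : {set 'I_m}) := residue op :|: [set mid i | i in a].
have Px a : P a \subset below x.
  rewrite subUset; apply/andP; split; last first.
    by apply/subsetP => _ /imsetP[i _ ->].
  by case: (op); rewrite /= ?sub0set //; apply/subsetP => _ /imsetP[i _ ->].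
set H := apply_op _ _ _.
(* The singletons [[set bot j]] read off [a] from its cofactor. *)
have botP a j : ([set bot j] \in cofactor x (P a) H) = (j \in a).
  rewrite !inE sub1set bot_ge /= -setUA matching_op; last first.
    rewrite subUset sub1set inE bot_selectors andbT.
    by apply/subsetP => _ /imsetP[i _ ->]; rewrite inE mid_selectors.
  apply/existsP/idP => [[i]|ja].
    rewrite !inE => /andP[/orP[/imsetP[k ka [->]]|/eqP//] /orP[/imsetP[]//|/eqP[<-]//]].
  by exists j; rewrite !inE eqxx orbT imset_f.
have cof_inj : injective (fun a => cofactor x (P a) H).
  by move=> a b E; apply/setP => j; rewrite -!botP E.
rewrite -{1}(card_ord m) -cardsT -card_powerset -(card_imset _ cof_inj).
by apply/subset_leq_card/subsetP => _ /imsetP[a _ ->]; apply: imset_f; rewrite inE.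
Qed.

Lemma card_ground_set : #|{: U}| = 3 * m.
Proof. by rewrite card_prod !card_ord. Qed.

Lemma zdd_size_matching_le : zdd_size matching <= 3 * m * (m + 2) + 2.
Proof.
apply: leq_trans (zdd_size_le_cofactors _) _.
rewrite leq_add2r -card_ground_set -sum_nat_const.
by apply: leq_sum => x _; exact: card_cofactors_matching.
Qed.

Lemma zdd_size_partner_le (op : family_op) : zdd_size (partner op) <= 3 * m * 2 + 2.
Proof.
apply: leq_trans (zdd_size_le_cofactors _) _.
rewrite leq_add2r -card_ground_set -sum_nat_const.
by apply: leq_sum => x _; case: op; exact: card_cofactors_interval.
Qed.

Lemma zdd_size_operands_le (op : family_op) : 0 < m ->
  zdd_size matching + zdd_size (partner op) <= 19 * m ^ 3.
Proof.
(* The two bounds add up to [3 * m ^ 2 + 12 * m + 4], and 3 + 12 + 4 = 19. *)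
move=> m_gt0; apply: leq_trans (leq_add zdd_size_matching_le (zdd_size_partner_le op)) _.
have : m ^ 2 <= m ^ 3 by rewrite leq_pexp2l.
have : m <= m ^ 2 by rewrite -{1}[m]expn1 leq_pexp2l.
by rewrite -mulnn; lia.
Qed.

End Construction.

(* Asymptotic form of the bounds *)
From mathcomp Require Import all_boot all_order all_algebra.
From mathcomp Require Import all_classical all_reals all_analysis.
Import GRing.Theory Num.Theory numFieldNormedType.Exports.
Local Open Scope classical_set_scope.
Local Open Scope ring_scope.

Theorem theorem7 (R : realType) (op : family_op) :
  exists (d : Order.disp_t) (U : nat -> finOrderType d)
         (F G : forall m : nat, {set {set U m}}),
    [/\ (fun m : nat => #|U m|%:R : R^o) =O_\oo (fun m : nat => m%:R : R^o),
        (fun m : nat => (zdd_size (F m) + zdd_size (G m))%:R : R^o)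
          =O_\oo (fun m : nat => m%:R ^+ 3 : R^o)
      & (fun m : nat => (zdd_size (apply_op op (F m) (G m)))%:R : R^o)
          =Omega_\oo (fun m : nat => 2 `^ (m%:R / 5) / m%:R : R^o)].
Proof.
exists _, (fun m => 'I_3 *l 'I_m)%type, matching, (fun m => partner m op); split.
- apply/eqO_exP; exists 3 => //; near=> m => /=.
  by rewrite card_ground_set natrM normrM !normr_nat.
- apply/eqO_exP; exists 19 => //; near=> m => /=.
  rewrite -natrX !normr_nat -natrM ler_nat.
  by apply: zdd_size_operands_le; near: m; exact: nbhs_infty_gt.
- rewrite eqOmegaE qualifE; apply/asboolP; exists 1 => //; near=> m => /=.
  have m_gt0 : (0 < m)%N by near: m; exact: nbhs_infty_gt.
  rewrite mul1r normr_nat ger0_norm ?divr_ge0 ?powR_ge0 //.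
  (* The construction even reaches [2 ^ m], which dominates the required bound with constant 1 as
     soon as [m] is positive. *)
  apply: le_trans (_ : (2 ^ m)%:R <= _); last by rewrite ler_nat expn_le_zdd_size_op.
  rewrite natrX -powR_mulrn // ler_pdivrMr ?ltr0n //.
  apply: le_trans (_ : 2 `^ m%:R <= _); last by rewrite ler_peMr ?powR_ge0 ?ler1n.
  by rewrite ler_powR ?ler1n // ler_pdivrMr // ler_peMr ?ler1n.
Unshelve. all: end_near. Qed.
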